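(* Let $r\ge1$ be an integer and let $R$ be a commutative ring with identity $1_R$ such that $r\cdot1_R$ is a unit in $R$ and $R$ contains a primitive $r$-th root of unity $\epsilon$. Let $B$ be an $R$-algebra which is a finitely generated free $R$-module with $R$-basis $b_1,\dots,b_s$. Let $A$ be a $\mathbb Z/r\mathbb Z$-graded $R$-algebra containing $B$ as a subalgebra, with grading $A=\bigoplus_{j=0}^{r-1}a^jB$ for a unit $a\in A$ satisfying $aB=Ba$ and $a^r\in B$. Let $\varphi:A\otimes_BA\to\bigoplus_{j=0}^{r-1}A^{\sigma^j}$ be the $R$-linear homomorphism defined on the $R$-basis $\{b_{i_1}a^{i_2}\otimes_Ba^{i_3}: 1\le i_1\le s,\ 0\le i_2,i_3<r\}$ of $A\otimes_BA$ by $$\varphi\bigl(b_{i_1}a^{i_2}\otimes_Ba^{i_3}\bigr)=\bigoplus_{j=0}^{r-1}\epsilon^{ji_3}\bigl(b_{i_1}a^{i_2+i_3}\bigr)_{(j)}.$$ Then $\varphi$ is an isomorphism of $(A,A)$-bimodules.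
   Context: $\sigma$ is the automorphism of $A$ given by $\sigma(a^jx)=\epsilon^ja^jx$ for all $x\in B$, $j\in\mathbb Z$. For $0\le j<r$, $A^{\sigma^j}$ equals $A$ as an $R$-module, with left $A$-action the usual left multiplication and right $A$-action the usual right multiplication twisted by $\sigma^j$ (i.e. $y\in A$ acts on the right as right multiplication by $\sigma^j(y)$). For $y\in A$, $(y)_{(j)}$ denotes the element $y$ regarded as an element of $A^{\sigma^j}$.
   Formalization: ''Primitive r-th root of unity'' is taken to mean ε^r = 1 and ε^i − 1 is not a zero divisor for 0 < i < r; with mere order r the claim fails (R = C×C, r = 2, ε = (1,−1), B = R, A = R[a]/(a²−1)). Over a domain the two notions agree. *)

(* Defs.v *)
From HB Require Import structures.
From mathcomp Require Import all_boot all_order all_algebra.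
From mathcomp Require Import generic_quotient ring_quotient.
From mathcomp Require Import boolp.
From mathcomp Require Import freeg.

Set Implicit Arguments.
Unset Strict Implicit.
Unset Printing Implicit Defensive.

Import GRing.Theory.
Local Open Scope ring_scope.
Local Open Scope quotient_scope.

(* [tensor B] is A (x)_B A: the free abelian group on [A * A], modulo the
   subgroup generated by the biadditivity relations and by the
   [(x b, y) - (x, b y)] for [b] in [B]. *)

Section Tensor.
Variables (A : nzRingType) (B : {pred A}).

Local Notation fg := {freeg (A * A) / int}.
Local Notation "x ** y" := (<< (x, y) >> : fg) (at level 40).

Inductive tens_rel : fg -> Prop :=
| tens_rel0 : tens_rel 0
| tens_relB u v : tens_rel u -> tens_rel v -> tens_rel (u - v)
| tens_relDl x x' y : tens_rel ((x + x') ** y - x ** y - x' ** y)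
| tens_relDr x y y' : tens_rel (x ** (y + y') - x ** y - x ** y')
| tens_relM x b y : b \in B -> tens_rel ((x * b) ** y - x ** (b * y)).

Definition tens_ker : {pred fg} := fun u => `[< tens_rel u >].

Lemma tens_kerP u : reflect (tens_rel u) (u \in tens_ker).
Proof. exact: asboolP. Qed.

Lemma tens_ker_zmod_closed : zmod_closed tens_ker.
Proof.
split=> [|u v /tens_kerP uI /tens_kerP vI]; apply/tens_kerP.
  exact: tens_rel0.
exact: tens_relB.
Qed.

HB.instance Definition _ :=
  GRing.isZmodClosed.Build fg tens_ker tens_ker_zmod_closed.

Definition tensor := Quotient.quot tens_ker.

HB.instance Definition _ := Choice.on tensor.
HB.instance Definition _ := GRing.Zmodule.on tensor.

Definition tens (x y : A) : tensor := \pi_tensor (x ** y).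

Lemma tens_pi0 u : tens_rel u -> \pi_tensor u = 0.
Proof.
move=> uI; rewrite -(raddf0 (\pi_tensor)); apply/eqP.
by rewrite -Quotient.idealrBE subr0; apply/tens_kerP.
Qed.

Lemma tensDl x x' y : tens (x + x') y = tens x y + tens x' y.
Proof.
apply/eqP; rewrite -subr_eq0 opprD addrA /tens -!raddfB /=.
by apply/eqP/tens_pi0/tens_relDl.
Qed.

Lemma tensDr x y y' : tens x (y + y') = tens x y + tens x y'.
Proof.
apply/eqP; rewrite -subr_eq0 opprD addrA /tens -!raddfB /=.
by apply/eqP/tens_pi0/tens_relDr.
Qed.

Lemma tensMb x b y : b \in B -> tens (x * b) y = tens x (b * y).
Proof.
move=> bB; apply/eqP; rewrite -subr_eq0 /tens -raddfB /=.
by apply/eqP/tens_pi0/tens_relM.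
Qed.

Lemma tens_ind (P : tensor -> Prop) :
  P 0 -> (forall u v, P u -> P v -> P (u - v)) ->
  (forall x y, P (tens x y)) -> forall t, P t.
Proof.
move=> P0 PB Pt t; rewrite -[t]reprK; move: (repr t) => u.
have PN v : P v -> P (- v) by move=> Pv; rewrite -sub0r; apply: PB.
have PD v w : P v -> P w -> P (v + w).
  by move=> Pv Pw; rewrite -[w]opprK; apply: PB => //; apply: PN.
rewrite -[u]freeg_sumE raddf_sum /=.
elim/big_ind: _ => // -[x y] _; set m := coeff _ _.
have -> : << m *g (x, y) >> = << (x, y) >> *~ m :> fg.
  by rewrite freegU_mulz intz.
have Pn n : P (\pi_tensor (x ** y) *+ n).
  by elim: n => [|n IHn]; rewrite ?mulr0n ?mulrS //; apply: PD => //; apply: Pt.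
case: m => n; first by rewrite -pmulrn raddfMn.
by rewrite NegzE -nmulrn raddfN raddfMn; apply: PN.
Qed.

Definition balanced (V : zmodType) (f : A -> A -> V) :=
  [/\ forall x x' y, f (x + x') y = f x y + f x' y,
      forall x y y', f x (y + y') = f x y + f x y'
    & forall x b y, b \in B -> f (x * b) y = f x (b * y)].

Definition tens_lift (V : zmodType) (f : A -> A -> V) (t : tensor) : V :=
  fglift (fun p => f p.1 p.2 : zmodule V) (repr t).

Section Lift.
Variables (V : zmodType) (f : A -> A -> V).
Hypothesis fbal : balanced f.

Let F := @fglift _ (zmodule V) _ (fun p : A * A => f p.1 p.2).

Let FB : {morph F : u v / u - v}.
Proof. exact: lift_is_additive. Qed.

Let F1 x y : F (x ** y) = f x y.
Proof. by rewrite /F liftU scale1r. Qed.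

Let Frel u : tens_rel u -> F u = 0.
Proof.
case: fbal => fDl fDr fM.
elim=> [|{}u v _ Fu _ Fv|x x' y|x y y'|x b y bB].
- by have := FB 0 0; rewrite !subrr.
- by rewrite FB Fu Fv subrr.
- by rewrite !FB !F1 fDl -addrA -opprD subrr.
- by rewrite !FB !F1 fDr -addrA -opprD subrr.
- by rewrite FB !F1 fM // subrr.
Qed.

Let Fpi u : tens_lift f (\pi_tensor u) = F u.
Proof.
apply/eqP; rewrite -subr_eq0; apply/eqP; rewrite -[LHS]FB.
by apply/Frel/tens_kerP; rewrite Quotient.idealrBE reprK.
Qed.

Lemma tens_liftE x y : tens_lift f (tens x y) = f x y.
Proof. by rewrite Fpi F1. Qed.

Lemma tens_lift_zmod_morphism : {morph tens_lift f : u v / u - v}.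
Proof.
by move=> u v; rewrite -[u]reprK -[v]reprK -raddfB !Fpi FB.
Qed.

Lemma tens_liftD : {morph tens_lift f : u v / u + v}.
Proof.
have L0 : tens_lift f 0 = 0.
  by have := tens_lift_zmod_morphism 0 0; rewrite !subrr.
have LN u : tens_lift f (- u) = - tens_lift f u.
  by rewrite -[- u]sub0r tens_lift_zmod_morphism L0 sub0r.
by move=> u v; rewrite -{1}[v]opprK tens_lift_zmod_morphism LN opprK.
Qed.

End Lift.

Lemma tens_ext (V : zmodType) (g h : tensor -> V) :
  {morph g : u v / u - v} -> {morph h : u v / u - v} ->
  (forall x y, g (tens x y) = h (tens x y)) -> g =1 h.
Proof.
move=> gB hB gh; apply: tens_ind => // [|u v gu gv].
  by rewrite -(subrr 0) gB hB !subrr.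
by rewrite gB hB gu gv.
Qed.

End Tensor.

Record bimodType (R : comUnitRingType) (A : algType R) := Bimod {
  bimod_sort :> lmodType R;
  lact : A -> bimod_sort -> bimod_sort;
  ract : bimod_sort -> A -> bimod_sort;
  _ : forall x, linear (lact x);
  _ : forall m, linear (lact^~ m);
  _ : forall y, linear (ract^~ y);
  _ : forall m, linear (ract m);
  _ : forall m, lact 1 m = m;
  _ : forall x x' m, lact (x * x') m = lact x (lact x' m);
  _ : forall m, ract m 1 = m;
  _ : forall m y y', ract m (y * y') = ract (ract m y) y';
  _ : forall x m y, ract (lact x m) y = lact x (ract m y)
}.

Definition bimod_isomorphism (R : comUnitRingType) (A : algType R)
    (M N : bimodType A) (f : M -> N) : Prop :=
  [/\ bijective f, linear f,
      forall x m, f (lact x m) = lact x (f m)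
    & forall m y, f (ract m y) = ract (f m) y].

Section TensorBimodule.
Variables (R : comUnitRingType) (A : algType R) (B : {pred A}).

Local Notation T := (tensor B).

Definition tens_scale (k : R) : T -> T :=
  tens_lift (fun x y => tens B (k *: x) y).
Definition tens_lact (c : A) : T -> T :=
  tens_lift (fun x y => tens B (c * x) y).
Definition tens_ract (t : T) (c : A) : T :=
  tens_lift (fun x y => tens B x (y * c)) t.

Let scale_bal k : balanced B (fun x y => tens B (k *: x) y).
Proof.
split=> [x x' y|x y y'|x b y bB]; first by rewrite scalerDr tensDl.
  by rewrite tensDr.
by rewrite scalerAl tensMb.
Qed.

Let lact_bal c : balanced B (fun x y => tens B (c * x) y).
Proof.
split=> [x x' y|x y y'|x b y bB]; first by rewrite mulrDr tensDl.
  by rewrite tensDr.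
by rewrite mulrA tensMb.
Qed.

Let ract_bal c : balanced B (fun x y => tens B x (y * c)).
Proof.
split=> [x x' y|x y y'|x b y bB]; first by rewrite tensDl.
  by rewrite mulrDl tensDr.
by rewrite -mulrA tensMb.
Qed.

Lemma tens_scaleE k x y : tens_scale k (tens B x y) = tens B (k *: x) y.
Proof. by rewrite /tens_scale tens_liftE. Qed.

Lemma tens_lactE c x y : tens_lact c (tens B x y) = tens B (c * x) y.
Proof. by rewrite /tens_lact tens_liftE. Qed.

Lemma tens_ractE x y c : tens_ract (tens B x y) c = tens B x (y * c).
Proof. by rewrite /tens_ract tens_liftE. Qed.

Let scaleB k : {morph tens_scale k : u v / u - v}.
Proof. exact: tens_lift_zmod_morphism. Qed.
Let lactB c : {morph tens_lact c : u v / u - v}.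
Proof. exact: tens_lift_zmod_morphism. Qed.
Let ractB c : {morph tens_ract^~ c : u v / u - v}.
Proof. exact: tens_lift_zmod_morphism. Qed.

Let lactD c : {morph tens_lact c : u v / u + v}.
Proof. exact: tens_liftD. Qed.
Let ractD c : {morph tens_ract^~ c : u v / u + v}.
Proof. exact: tens_liftD. Qed.

Let addB (g h : T -> T) : {morph g : u v / u - v} ->
  {morph h : u v / u - v} -> {morph (fun t => g t + h t) : u v / u - v}.
Proof. by move=> gB hB u v; rewrite gB hB opprD addrACA. Qed.

Let compB (g h : T -> T) : {morph g : u v / u - v} ->
  {morph h : u v / u - v} -> {morph (fun t => g (h t)) : u v / u - v}.
Proof. by move=> gB hB u v; rewrite hB gB. Qed.

Let idB : {morph (fun t : T => t) : u v / u - v}.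
Proof. by []. Qed.

Fact tens_scaleA k l t : tens_scale k (tens_scale l t) = tens_scale (k * l) t.
Proof.
move: t; apply: tens_ext; [exact: compB | exact: scaleB |].
by move=> x y; rewrite !tens_scaleE scalerA.
Qed.

Fact tens_scale1 : left_id 1 tens_scale.
Proof.
move=> t; move: t; apply: tens_ext; [exact: scaleB | exact: idB |].
by move=> x y; rewrite tens_scaleE scale1r.
Qed.

Fact tens_scaleDr : right_distributive tens_scale +%R.
Proof. by move=> k u v; rewrite /tens_scale tens_liftD. Qed.

Fact tens_scaleDl t : {morph tens_scale^~ t : k l / k + l}.
Proof.
move=> k l; move: t; apply: tens_ext; [exact: scaleB | exact: addB |].
by move=> x y; rewrite !tens_scaleE scalerDl tensDl.
Qed.

HB.instance Definition _ := GRing.Zmodule_isLmodule.Build R T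
  tens_scaleA tens_scale1 tens_scaleDr tens_scaleDl.

Lemma tensZl k x y : k *: tens B x y = tens B (k *: x) y.
Proof. exact: tens_scaleE. Qed.

Let lact_linear c : linear (tens_lact c).
Proof.
move=> k u v; rewrite lactD; congr (_ + _).
move: u; apply: tens_ext.
- exact: (compB (lactB c) (scaleB k)).
- exact: (compB (scaleB k) (lactB c)).
- by move=> x y; rewrite tens_lactE !tensZl tens_lactE scalerAr.
Qed.

Let lact_linearl t : linear (tens_lact^~ t).
Proof.
move=> k c d; move: t; apply: tens_ext.
- exact: lactB.
- exact: (addB (compB (scaleB k) (lactB c)) (lactB d)).
- by move=> x y; rewrite !tens_lactE mulrDl tensDl tensZl scalerAl.
Qed.

Let ract_linear c : linear (tens_ract^~ c).
Proof.
move=> k u v; rewrite ractD; congr (_ + _).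
move: u; apply: tens_ext.
- exact: (compB (ractB c) (scaleB k)).
- exact: (compB (scaleB k) (ractB c)).
- by move=> x y; rewrite tens_ractE !tensZl tens_ractE.
Qed.

Hypothesis Balg : GRing.subalg_closed B.

Lemma tensZr k x y : k *: tens B x y = tens B x (k *: y).
Proof.
have kB : k%:A \in B.
  have [B1 BZ _] := Balg.
  have B0 : 0 \in B.
    by have := BZ (-1) 1 1 B1 B1; rewrite scaleN1r addNr.
  by rewrite -[k%:A]addr0 BZ.
rewrite tensZl -[k *: x]mulr1 -scalerAl scalerAr tensMb //.
by rewrite -scalerAl mul1r.
Qed.

Let ract_linearr t : linear (tens_ract t).
Proof.
move=> k c d; move: t; apply: tens_ext.
- exact: ractB.
- exact: (addB (compB (scaleB k) (ractB c)) (ractB d)).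
- by move=> x y; rewrite !tens_ractE mulrDr tensDr tensZr scalerAr.
Qed.

Let lact1 t : tens_lact 1 t = t.
Proof.
move: t; apply: tens_ext; [exact: lactB | exact: idB |].
by move=> x y; rewrite tens_lactE mul1r.
Qed.

Let lactM c d t : tens_lact (c * d) t = tens_lact c (tens_lact d t).
Proof.
move: t; apply: tens_ext; [exact: lactB | exact: compB |].
by move=> x y; rewrite !tens_lactE mulrA.
Qed.

Let ract1 t : tens_ract t 1 = t.
Proof.
move: t; apply: tens_ext; [exact: ractB | exact: idB |].
by move=> x y; rewrite tens_ractE mulr1.
Qed.

Let ractM t c d : tens_ract t (c * d) = tens_ract (tens_ract t c) d.
Proof.
move: t; apply: tens_ext; [exact: ractB | exact: (compB (ractB d)) |].
by move=> x y; rewrite !tens_ractE mulrA.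
Qed.

Let lractA c t d : tens_ract (tens_lact c t) d = tens_lact c (tens_ract t d).
Proof.
move: t; apply: tens_ext.
- exact: (compB (ractB d) (lactB c)).
- exact: (compB (lactB c) (ractB d)).
- by move=> x y; rewrite !(tens_lactE, tens_ractE).
Qed.

Definition tensor_bimod : bimodType A :=
  @Bimod R A T tens_lact tens_ract lact_linear lact_linearl ract_linear
    ract_linearr lact1 lactM ract1 ractM lractA.

End TensorBimodule.

(* The direct sum of the A^(sigma^j), 0 <= j < r, is carried by the functions
   ['I_r -> A], whose value at [j] is the component in A^(sigma^j); as an
   R-module each summand is A, so (y)_(j) is just [y] at coordinate [j]. *)

Section TwistedSum.
Variables (R : comUnitRingType) (A : algType R).
Variables (sigma : {lrmorphism A -> A}) (r : nat).

Local Notation S := {ffun 'I_r -> A}.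

Definition twist_lact (x : A) (f : S) : S := [ffun j => x * f j].
Definition twist_ract (f : S) (y : A) : S :=
  [ffun j => f j * iter j sigma y].

Let iter_linear j : linear (iter j sigma).
Proof. by move=> k x y; elim: j => //= j ->; rewrite linearP. Qed.

Let iter1 j : iter j sigma 1 = 1.
Proof. by elim: j => //= j ->; rewrite rmorph1. Qed.

Let iterM j : {morph iter j sigma : x y / x * y}.
Proof. by move=> x y; elim: j => //= j ->; rewrite rmorphM. Qed.

Let lact_linear x : linear (twist_lact x).
Proof. by move=> k f g; apply/ffunP=> j; rewrite !ffunE mulrDr scalerAr. Qed.

Let lact_linearl f : linear (twist_lact^~ f).
Proof. by move=> k x y; apply/ffunP=> j; rewrite !ffunE mulrDl scalerAl. Qed.

Let ract_linear y : linear (twist_ract^~ y).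
Proof. by move=> k f g; apply/ffunP=> j; rewrite !ffunE mulrDl scalerAl. Qed.

Let ract_linearr f : linear (twist_ract f).
Proof.
by move=> k x y; apply/ffunP=> j; rewrite !ffunE iter_linear mulrDr scalerAr.
Qed.

Let lact1 f : twist_lact 1 f = f.
Proof. by apply/ffunP=> j; rewrite !ffunE mul1r. Qed.

Let lactM x y f : twist_lact (x * y) f = twist_lact x (twist_lact y f).
Proof. by apply/ffunP=> j; rewrite !ffunE mulrA. Qed.

Let ract1 f : twist_ract f 1 = f.
Proof. by apply/ffunP=> j; rewrite !ffunE iter1 mulr1. Qed.

Let ractM f x y : twist_ract f (x * y) = twist_ract (twist_ract f x) y.
Proof. by apply/ffunP=> j; rewrite !ffunE iterM mulrA. Qed.

Let lractA x f y : twist_ract (twist_lact x f) y = twist_lact x (twist_ract f y).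
Proof. by apply/ffunP=> j; rewrite !ffunE mulrA. Qed.

Definition twisted_sum_bimod : bimodType A :=
  @Bimod R A S twist_lact twist_ract lact_linear lact_linearl ract_linear
    ract_linearr lact1 lactM ract1 ractM lractA.

End TwistedSum.

Definition is_basis (R : comUnitRingType) (M : lmodType R) (I : finType)
    (P : M -> Prop) (e : I -> M) : Prop :=
  (forall i, P (e i)) /\
  (forall m, P m -> exists! c : {ffun I -> R}, m = \sum_i c i *: e i).

(* Over a commutative ring with zero divisors, primitivity of a root of unity
   has to mean that the [z ^+ i - 1] with [0 < i < r] are not zero divisors,
   and not just that they are nonzero. Over a domain this is
   [r.-primitive_root] (see [primitive_unity_rootE]). *)
Definition primitive_unity_root (R : comUnitRingType) (r : nat) (z : R) :=
  z ^+ r = 1 /\ forall i, (0 < i < r)%N -> GRing.lreg (z ^+ i - 1).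

Lemma primitive_unity_rootE (R : idomainType) (r : nat) (z : R) :
  (0 < r)%N -> primitive_unity_root r z <-> r.-primitive_root z.
Proof.
move=> r_gt0; split=> [[zr zi]|zP]; last first.
  split=> [|i /andP[i_gt0 ltir]]; first exact: prim_expr_order.
  apply/lregP; rewrite subr_eq0 -(prim_order_dvd zP).
  by rewrite gtnNdvd.
apply/andP; split=> //; apply/forallP=> i; rewrite unity_rootE.
have [->|neq] := eqVneq i.+1 r; first by rewrite zr eqxx.
have ltir : (0 < i.+1 < r)%N by rewrite /= ltn_neqAle neq ltn_ord.
by have /lregP := zi _ ltir; rewrite subr_eq0 => /negPf->.
Qed.

(* [G j], for [j < r], is the component of degree [j] of a grading of [A] by
   Z/rZ; [G] is not constrained at [j >= r]. *)
Definition Zmod_graded (R : comUnitRingType) (A : algType R) (r : nat)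
    (G : nat -> A -> Prop) : Prop :=
  [/\ forall j, (j < r)%N ->
        G j 0 /\ forall (k : R) x y, G j x -> G j y -> G j (k *: x + y),
      forall y : A, exists! f : {ffun 'I_r -> A},
        (forall j : 'I_r, G j (f j)) /\ y = \sum_j f j
    & forall i j x y, (i < r)%N -> (j < r)%N ->
        G i x -> G j y -> G ((i + j) %% r)%N (x * y)].

Definition lmul_set (A : nzRingType) (c : A) (B : {pred A}) : A -> Prop :=
  fun y => exists2 x, x \in B & y = c * x.

Definition rmul_set (A : nzRingType) (B : {pred A}) (c : A) : A -> Prop :=
  fun y => exists2 x, x \in B & y = x * c.

Section Phi.
Variables (R : comUnitRingType) (A : algType R) (B : {pred A}).
Variables (r s : nat) (eps : R) (a : A) (b : 'I_s -> A).

Definition tens_family (i : 'I_s * 'I_r * 'I_r) : tensor B :=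
  tens B (b i.1.1 * a ^+ i.1.2) (a ^+ i.2).

Definition phi_spec (phi : tensor B -> {ffun 'I_r -> A}) : Prop :=
  linear phi /\
  forall (i1 : 'I_s) (i2 i3 : 'I_r),
    phi (tens_family (i1, i2, i3)) =
    [ffun j : 'I_r => eps ^+ (j * i3) *: (b i1 * a ^+ (i2 + i3))].

End Phi.

(* Main.v *)
Require Import Defs.
From mathcomp Require Import all_boot all_order all_algebra.

Set Implicit Arguments.
Unset Strict Implicit.
Unset Printing Implicit Defensive.

Import GRing.Theory.
Local Open Scope ring_scope.

(** Since [sigma] fixes [B] pointwise and [sigma (a ^+ m) = eps ^+ m *: a ^+ m],
    the map prescribed on the family [b_i a^k (x) a^m] is the restriction of
    the basis-free map [twist : x (x) y |-> (x * sigma^j y)_j].  This formula is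
    B-balanced, and it visibly commutes with the left action and with the right
    action twisted by [sigma^j].

    Since [A] is the sum of the [B a^m], every tensor can be written
    [\sum_m x_m (x) a^m] with [x_m] in [A] ([tens_span]), and [twist] sends it
    to the function [j |-> \sum_m eps^(j m) x_m a^m], that is, to the discrete
    Fourier transform of [m |-> x_m a^m] ([twist_sum]).  As [r] is
    invertible and the powers of [eps] satisfy the orthogonality relations, this
    transform is inverted by the usual formula ([fourierK], [fourier_inv]);
    [a] being a unit, the [x_m] are recovered from the image.  Hence [twist] is
    bijective, and [A (x)_B A] is free as a left [A]-module on the [1 (x) a^m]
    ([tens_free]).  Combined with the R-basis [b_i a^k] of [A] given by the
    grading, this yields the R-basis of the tensor product
    ([tens_family_basis]), on which a linear map is determined by its values:
    every [phi] with the prescribed values equals [twist]. *)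

(** * Discrete Fourier inversion over a commutative ring *)

Section FourierInversion.
Variables (R : comUnitRingType) (r : nat) (eps : R).
Hypotheses (r_gt0 : (0 < r)%N) (r_unit : (r%:R : R) \is a GRing.unit).
Hypothesis eps_prim : primitive_unity_root r eps.

Let eps_r : eps ^+ r = 1.
Proof. by case: eps_prim. Qed.

Lemma primitive_root_unit : eps \is a GRing.unit.
Proof.
by apply/unitrPr; exists (eps ^+ r.-1); rewrite -exprS prednK.
Qed.

(** The factor [eps ^+ n - 1] kills the sum, as [eps ^+ (n * r) = 1], and it
    can be cancelled because [eps] is primitive in the strong sense. *)
Lemma geometric_sum_eq0 n : ~~ (r %| n)%N ->
  \sum_(j < r) eps ^+ (n * j) = 0.
Proof.
move=> ndvd; have [_ /(_ (n %% r)%N)] := eps_prim.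
rewrite lt0n ndvd ltn_pmod // (expr_mod _ eps_r) => /(_ isT) reg.
apply: reg; rewrite mulr0; under eq_bigr do rewrite exprM.
by rewrite -subrX1 exprAC eps_r expr1n subrr.
Qed.

Lemma character_orthogonality (i m : 'I_r) :
  \sum_(j < r) eps ^- (i * j) * eps ^+ (m * j) = r%:R *+ (i == m).
Proof.
have U := primitive_root_unit.
have [->|neq] := eqVneq i m.
  under eq_bigr do rewrite mulVr ?unitrX //.
  by rewrite sumr_const card_ord.
(* The quotient of the two characters is a power of [eps] with natural exponent
   [m + (r - i)], which is divisible by [r] only if [i = m]. *)
have E j : eps ^- (i * j) * eps ^+ (m * j) = eps ^+ ((m + (r - i)) * j).
  apply: (mulrI (unitrX (i * j) U)); rewrite mulrA mulrV ?unitrX // mul1r.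
  rewrite -exprD -mulnDl addnCA subnKC ?(ltnW (ltn_ord i)) //.
  by rewrite mulnDl exprD [eps ^+ (r * j)]exprM eps_r expr1n mulr1.
rewrite (eq_bigr _ (fun j _ => E (val j))) geometric_sum_eq0 //.
apply: contra neq => dvd; apply/eqP/val_inj/eqP => /=.
have : m + (r - i) == 0 %[mod r] by rewrite mod0n.
rewrite -(eqn_modDr i) add0n -addnA subnK ?(ltnW (ltn_ord i)) //.
by rewrite modnDr !modn_small // eq_sym.
Qed.

Definition fourier (V : lmodType R) (f : 'I_r -> V) (m : 'I_r) : V :=
  r%:R^-1 *: \sum_(j < r) eps ^- (m * j) *: f j.

Lemma fourierK (V : lmodType R) (f : 'I_r -> V) (j : 'I_r) :
  \sum_(m < r) eps ^+ (j * m) *: fourier f m = f j.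
Proof.
transitivity (r%:R^-1 *: \sum_(k < r)
  (\sum_(m < r) eps ^- (k * m) * eps ^+ (j * m)) *: f k).
  rewrite scaler_sumr; under eq_bigr do
    rewrite /fourier !scaler_sumr.
  rewrite exchange_big; apply: eq_bigr => k _.
  rewrite scaler_suml scaler_sumr; apply: eq_bigr => m _.
  by rewrite !scalerA mulrCA [(m * k)%N]mulnC [eps ^+ _ * _]mulrC.
under eq_bigr do rewrite character_orthogonality.
rewrite (bigD1 j) //= big1 => [|k /negPf->]; last by rewrite mulr0n scale0r.
by rewrite addr0 eqxx scalerA mulVr // scale1r.
Qed.

Lemma fourier_inv (V : lmodType R) (g : 'I_r -> V) m :
  fourier (fun j : 'I_r => \sum_(k < r) eps ^+ (j * k) *: g k) m = g m.
Proof.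
transitivity (r%:R^-1 *: \sum_(k < r)
  (\sum_(j < r) eps ^- (m * j) * eps ^+ (k * j)) *: g k).
  congr (_ *: _); under eq_bigr do rewrite scaler_sumr.
  rewrite exchange_big; apply: eq_bigr => k _.
  rewrite scaler_suml; apply: eq_bigr => j _.
  by rewrite scalerA [(j * k)%N]mulnC.
under eq_bigr do rewrite character_orthogonality.
rewrite (bigD1 m) //= big1 => [|k]; last first.
  by rewrite eq_sym => /negPf->; rewrite mulr0n scale0r.
by rewrite addr0 eqxx scalerA mulVr // scale1r.
Qed.

End FourierInversion.

(** * Bases and linear maps *)

Lemma is_basisP (R : comUnitRingType) (M : lmodType R) (I : finType)
    (P : M -> Prop) (e : I -> M) :
  (forall i, P (e i)) ->
  (forall m, P m -> exists c : I -> R, m = \sum_i c i *: e i) ->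
  (forall c d : I -> R,
     \sum_i c i *: e i = \sum_i d i *: e i -> c =1 d) ->
  is_basis P e.
Proof.
move=> Pe span free; split=> // m /span[c ->]; exists (finfun c); split.
  by apply: eq_bigr => i _; rewrite ffunE.
by move=> d /free E; apply/ffunP=> i; rewrite ffunE.
Qed.

Lemma is_basis_free (R : comUnitRingType) (M : lmodType R) (I : finType)
    (P : M -> Prop) (e : I -> M) (c d : I -> R) :
  is_basis P e -> P (\sum_i c i *: e i) ->
  \sum_i c i *: e i = \sum_i d i *: e i -> c =1 d.
Proof.
move=> [_ uniq] /uniq[f [_ fU]] E i.
have fc : f = finfun c by apply: fU; apply: eq_bigr => k _; rewrite ffunE.
have fd : f = finfun d.
  by apply: fU; rewrite E; apply: eq_bigr => k _; rewrite ffunE.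
by rewrite -(ffunE c) -fc fd ffunE.
Qed.

Lemma linear_morphB (R : comUnitRingType) (M N : lmodType R) (g : M -> N) :
  linear g -> {morph g : u v / u - v}.
Proof.
by move=> gL u v; rewrite ![_ - v]addrC -!scaleN1r gL scaleN1r addrC.
Qed.

Lemma linear_lincomb (R : comUnitRingType) (M N : lmodType R) (g : M -> N)
    (I : finType) (c : I -> R) (e : I -> M) :
  linear g -> g (\sum_i c i *: e i) = \sum_i c i *: g (e i).
Proof.
move=> gL; have g0 : g 0 = 0.
  by have := linear_morphB gL 0 0; rewrite !subrr.
have gD : {morph g : u v / u + v}.
  by move=> u v; have := gL 1 u v; rewrite !scale1r.
rewrite (big_morph g gD g0); apply: eq_bigr => i _.
by have := gL (c i) (e i) 0; rewrite !addr0 g0 addr0.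
Qed.

Lemma lact_linear (R : comUnitRingType) (A : algType R) (M : bimodType A) x :
  linear (@lact R A M x).
Proof. by case: M. Qed.

Lemma ract_linear (R : comUnitRingType) (A : algType R) (M : bimodType A) y :
  linear ((@ract R A M)^~ y).
Proof. by case: M. Qed.

(** * The basis of the graded algebra and of its tensor square *)

Section CyclicTensor.
Variables (r : nat) (R : comUnitRingType) (eps : R) (A : unitAlgType R).
Variables (B : {pred A}) (s : nat) (b : 'I_s -> A) (a : A).
Variable sigma : {lrmorphism A -> A}.
Hypotheses (r_gt0 : (0 < r)%N) (r_unit : (r%:R : R) \is a GRing.unit).
Hypothesis eps_prim : primitive_unity_root r eps.
Hypothesis B_subalg : GRing.subalg_closed B.
Hypothesis b_basis : is_basis (fun x : A => x \in B) b.
Hypothesis a_unit : a \is a GRing.unit.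
Hypothesis aB_Ba : forall y : A, lmul_set a B y <-> rmul_set B a y.
Hypothesis A_graded : Zmod_graded r (fun j => lmul_set (a ^+ j) B).
Hypothesis sigmaE : forall (j : int) (x : A), x \in B ->
  sigma (a ^ j * x) = eps ^ j *: (a ^ j * x).

Local Notation T := (tensor B).

Lemma expr_lmul_rmul n y : lmul_set (a ^+ n) B y <-> rmul_set B (a ^+ n) y.
Proof.
elim: n y => [|n IHn] y.
  by split=> -[x xB ->]; exists x; rewrite ?expr0 ?mul1r ?mulr1.
split=> -[x xB ->].
  have [x1 x1B E1] : rmul_set B (a ^+ n) (a ^+ n * x) by apply/IHn; exists x.
  have [x2 x2B E2] : rmul_set B a (a * x1) by apply/aB_Ba; exists x1.
  by exists x2; rewrite // exprS -mulrA E1 !mulrA E2.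
have [x1 x1B E1] : lmul_set a B (x * a) by apply/aB_Ba; exists x.
have [x2 x2B E2] : lmul_set (a ^+ n) B (x1 * a ^+ n) by apply/IHn; exists x1.
by exists x2; rewrite // exprS mulrA E1 -!mulrA E2.
Qed.

(** The homogeneous components lie in [a^j B]; moving [B] to the left of the
    powers of [a] is what lets it act on the left factor of a tensor. *)
Lemma graded_span y : exists2 x : 'I_r -> A,
  forall j, x j \in B & y = \sum_j x j * a ^+ j.
Proof.
have [_ /(_ y)[f [[Gf ->] _]] _] := A_graded.
have /fin_all_exists2[x xB fE] j : exists2 x, x \in B & f j = x * a ^+ j.
  by have /expr_lmul_rmul[x xB ->] := Gf j; exists x.
by exists x => //; apply: eq_bigr.
Qed.

Lemma graded_free (x x' : 'I_r -> A) :
    (forall j, x j \in B) -> (forall j, x' j \in B) ->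
  \sum_j x j * a ^+ j = \sum_j x' j * a ^+ j -> x =1 x'.
Proof.
move=> xB x'B E j.
have [_ /(_ (\sum_j x j * a ^+ j))[f [_ fU]] _] := A_graded.
have fx : f = [ffun j : 'I_r => x j * a ^+ j].
  apply: fU; split=> [k|]; last by apply: eq_bigr => k _; rewrite ffunE.
  by rewrite ffunE; apply/expr_lmul_rmul; exists (x k).
have fx' : f = [ffun j : 'I_r => x' j * a ^+ j].
  apply: fU; split=> [k|]; last by rewrite E; apply: eq_bigr => k _; rewrite ffunE.
  by rewrite ffunE; apply/expr_lmul_rmul; exists (x' k).
apply: (mulIr (unitrX j a_unit)).
by move/ffunP: (etrans (esym fx) fx') => /(_ j); rewrite !ffunE.
Qed.

Lemma lincomb_in (c : 'I_s -> R) : \sum_i c i *: b i \in B.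
Proof.
have [B1 BZ _] := B_subalg.
have B0 : 0 \in B by have := BZ (-1) 1 1 B1 B1; rewrite scaleN1r addNr.
elim/big_ind: _ => // [x y xB yB|i _].
  by rewrite -[x]scale1r BZ.
by rewrite -[_ *: _]addr0 BZ //; case: b_basis.
Qed.

Lemma graded_basis :
  is_basis (fun _ : A => True) (fun i : 'I_s * 'I_r => b i.1 * a ^+ i.2).
Proof.
have sumE (c : 'I_s * 'I_r -> R) : \sum_i c i *: (b i.1 * a ^+ i.2) =
    \sum_(j < r) (\sum_i c (i, j) *: b i) * a ^+ j.
  transitivity (\sum_i \sum_(j < r) c (i, j) *: (b i * a ^+ j)).
    by rewrite pair_bigA; apply: eq_bigr => -[].
  rewrite exchange_big; apply: eq_bigr => j _; rewrite mulr_suml.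
  by apply: eq_bigr => i _; rewrite scalerAl.
apply: is_basisP => // [y _|c d].
  have [x xB ->] := graded_span y.
  have /fin_all_exists[c cE] j : exists c : 'I_s -> R, x j = \sum_i c i *: b i.
    by have [_ /(_ _ (xB j))[c [-> _]]] := b_basis; exists c.
  exists (fun i => c i.2 i.1); rewrite sumE; apply: eq_bigr => j _.
  by rewrite cE.
rewrite !sumE => /graded_free E [i j].
apply: (is_basis_free (c := fun i => c (i, j)) (d := fun i => d (i, j)) b_basis).
  exact: lincomb_in.
by apply: (E _ _ j) => k; apply: lincomb_in.
Qed.

Lemma tens_suml (I : Type) (q : seq I) (F : I -> A) y :
  tens B (\sum_(i <- q) F i) y = \sum_(i <- q) tens B (F i) y.
Proof.
apply: (big_morph (fun x => tens B x y)) => [x x'|]; first exact: tensDl.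
by apply: (addrI (tens B 0 y)); rewrite -tensDl !addr0.
Qed.

Lemma tens_sumr (I : Type) (q : seq I) (F : I -> A) x :
  tens B x (\sum_(i <- q) F i) = \sum_(i <- q) tens B x (F i).
Proof.
apply: (big_morph (tens B x)) => [y y'|]; first exact: tensDr.
by apply: (addrI (tens B x 0)); rewrite -tensDr !addr0.
Qed.

(** Writing the right factor as [\sum_m z_m a^m], the [z_m] in [B] pass to
    the left factor. *)
Lemma tens_span t : exists x : 'I_r -> A, t = \sum_m tens B (x m) (a ^+ m).
Proof.
elim/tens_ind: t => [|u v [x ->] [x' ->]|x y].
- exists (fun=> 0); rewrite big1 // => m _.
  by apply: (addrI (tens B 0 (a ^+ m))); rewrite -tensDl !addr0.
- exists (fun m => x m - x' m); rewrite -sumrB; apply: eq_bigr => m _.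
  by apply/eqP; rewrite subr_eq -tensDl subrK.
have [z zB ->] := graded_span y; exists (fun m => x * z m).
by rewrite tens_sumr; apply: eq_bigr => m _; rewrite tensMb.
Qed.

Lemma sigma_id x : x \in B -> sigma x = x.
Proof. by move=> xB; have := sigmaE 0 xB; rewrite !expr0z mul1r scale1r. Qed.

Lemma iter_sigmaX j m : iter j sigma (a ^+ m) = eps ^+ (j * m) *: a ^+ m.
Proof.
have [B1 _ _] := B_subalg.
elim: j => [|j IHj] /=; first by rewrite mul0n scale1r.
have /= := sigmaE m%:Z B1; rewrite -!exprnP mulr1 => E.
by rewrite IHj linearZ /= E scalerA -exprD mulSn addnC.
Qed.

(** The basis-free form of the map, with values in the sum of the twisted
    bimodules [A^(sigma^j)]. *)
Definition twist (t : T) : {ffun 'I_r -> A} :=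
  tens_lift (fun x y => [ffun j : 'I_r => x * iter j sigma y]) t.

Let twist_balanced :
  balanced B (fun x y => [ffun j : 'I_r => x * iter j sigma y]).
Proof.
have iterB j x y : x \in B -> iter j sigma (x * y) = x * iter j sigma y.
  by move=> xB; elim: j => //= j ->; rewrite rmorphM /= sigma_id.
have iterD j : {morph iter j sigma : x y / x + y}.
  by move=> x y; elim: j => //= j ->; rewrite rmorphD.
split=> [x x' y|x y y'|x z y zB]; apply/ffunP=> j; rewrite !ffunE.
- by rewrite mulrDl.
- by rewrite iterD mulrDr.
by rewrite iterB // mulrA.
Qed.

Lemma twistE x y : twist (tens B x y) = [ffun j : 'I_r => x * iter j sigma y].
Proof. exact: tens_liftE. Qed.

Lemma twistB : {morph twist : u v / u - v}.
Proof. exact: tens_lift_zmod_morphism. Qed.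

Lemma twistD : {morph twist : u v / u + v}.
Proof. exact: tens_liftD. Qed.

(** In the coordinates of [tens_span], [twist] is a discrete Fourier
    transform. *)
Lemma twist_sum (x : 'I_r -> A) j :
  twist (\sum_m tens B (x m) (a ^+ m)) j =
  \sum_(m < r) eps ^+ (j * m) *: (x m * a ^+ m).
Proof.
rewrite (big_morph twist twistD (id1 := 0)); last first.
  by have := twistB 0 0; rewrite !subrr.
rewrite sum_ffunE; apply: eq_bigr => m _.
by rewrite twistE ffunE iter_sigmaX scalerAr.
Qed.

(** The Fourier coefficient of index [m] is [x_m a^m], and [a ^- m] extracts
    [x_m]. *)
Definition untwist (f : {ffun 'I_r -> A}) : T :=
  \sum_m tens B (fourier eps f m * a ^- m) (a ^+ m).

Lemma untwistK : cancel untwist twist.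
Proof.
move=> f; apply/ffunP=> j; rewrite twist_sum.
under eq_bigr do rewrite divrK ?unitrX //.
exact: fourierK.
Qed.

Lemma fourier_twist (x : 'I_r -> A) m :
  fourier eps (twist (\sum_m tens B (x m) (a ^+ m))) m * a ^- m = x m.
Proof.
rewrite -[RHS](mulrK (unitrX m a_unit)); congr (_ * _).
rewrite -[RHS](fourier_inv r_gt0 r_unit eps_prim (fun k => x k * a ^+ k)).
by congr (_ *: _); apply: eq_bigr => j _; rewrite twist_sum.
Qed.

Lemma twistK : cancel twist untwist.
Proof.
move=> t; have [x ->] := tens_span t.
by apply: eq_bigr => m _; rewrite fourier_twist.
Qed.

(** Left [A]-linear independence of the [1 (x) a^m]: the coefficients are read
    off the Fourier coefficients of the image under [twist]. *)
Lemma tens_free (x x' : 'I_r -> A) :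
  \sum_m tens B (x m) (a ^+ m) = \sum_m tens B (x' m) (a ^+ m) -> x =1 x'.
Proof. by move=> E m; rewrite -fourier_twist E fourier_twist. Qed.

Lemma tens_family_basis :
  is_basis (fun _ : T => True) (@tens_family R A B r s a b).
Proof.
have sumE (c : 'I_s * 'I_r * 'I_r -> R) :
    \sum_i c i *: tens_family B a b i =
    \sum_(m < r) tens B (\sum_i c (i, m) *: (b i.1 * a ^+ i.2)) (a ^+ m).
  transitivity (\sum_i \sum_(m < r) c (i, m) *: tens_family B a b (i, m)).
    by rewrite pair_bigA; apply: eq_bigr => -[].
  rewrite exchange_big; apply: eq_bigr => m _; rewrite tens_suml.
  by apply: eq_bigr => i _; rewrite tensZl.
apply: is_basisP => // [t _|c d].
  have [x ->] := tens_span t.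
  have /fin_all_exists[c cE] m : exists c : 'I_s * 'I_r -> R,
      x m = \sum_i c i *: (b i.1 * a ^+ i.2).
    by have [_ /(_ (x m) I)[c [-> _]]] := graded_basis; exists c.
  exists (fun i => c i.2 i.1); rewrite sumE; apply: eq_bigr => m _.
  by rewrite cE.
rewrite !sumE => /tens_free E [i m].
exact: (is_basis_free (c := fun i => c (i, m)) (d := fun i => d (i, m))
  graded_basis I (E m)).
Qed.

(** * Bimodule structure and comparison with the prescribed map *)

Lemma twist_linear : linear twist.
Proof.
move=> k u v; rewrite twistD; congr (_ + _).
have [x ->] := tens_span u.
have -> : k *: (\sum_m tens B (x m) (a ^+ m)) =
    \sum_m tens B (k *: x m) (a ^+ m) :> T.
  by rewrite scaler_sumr; apply: eq_bigr => m _; rewrite tensZl.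
apply/ffunP=> j; rewrite !ffunE !twist_sum scaler_sumr.
by apply: eq_bigr => m _; rewrite -scalerAl scalerA mulrC -scalerA.
Qed.

Lemma twist_spec : phi_spec eps a b twist.
Proof.
split=> [|i1 i2 i3]; first exact: twist_linear.
apply/ffunP=> j; rewrite twistE !ffunE iter_sigmaX.
by rewrite -scalerAr -mulrA exprD.
Qed.

Lemma phi_spec_twist phi : phi_spec eps a b phi -> phi =1 twist.
Proof.
move=> [phiL phiE] t.
have [_ /(_ t I)[c [-> _]]] := tens_family_basis.
rewrite !linear_lincomb //; last exact: twist_linear.
apply: eq_bigr => -[[i1 i2] i3] _.
by rewrite phiE (proj2 twist_spec).
Qed.

Lemma twist_lactE x t : twist (tens_lact x t) = twist_lact x (twist t).
Proof.
move: t; apply: tens_ext => [u v|u v|y z].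
- rewrite -twistB; congr (twist _).
  exact: (linear_morphB (lact_linear (M := tensor_bimod B_subalg) x)).
- by rewrite twistB; apply/ffunP=> j; rewrite !ffunE mulrBr.
- by rewrite tens_lactE !twistE; apply/ffunP=> j; rewrite !ffunE mulrA.
Qed.

Lemma twist_ractE t y : twist (tens_ract t y) = twist_ract sigma (twist t) y.
Proof.
have iterM j : {morph iter j sigma : x z / x * z}.
  by move=> x z; elim: j => //= j ->; rewrite rmorphM.
move: t; apply: tens_ext => [u v|u v|x z].
- rewrite -twistB; congr (twist _).
  exact: (linear_morphB (ract_linear (M := tensor_bimod B_subalg) y)).
- by rewrite twistB; apply/ffunP=> j; rewrite !ffunE mulrBl.
- by rewrite tens_ractE !twistE; apply/ffunP=> j; rewrite !ffunE iterM mulrA.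
Qed.

Lemma twist_isomorphism phi : phi =1 twist ->
  bimod_isomorphism (M := tensor_bimod B_subalg)
    (N := twisted_sum_bimod sigma r) phi.
Proof.
move=> phiE; split=> [|k u v|x t|t y].
- by exists untwist => [t|f]; rewrite phiE ?twistK ?untwistK.
- by rewrite !phiE; apply: twist_linear.
- by rewrite !phiE; apply: twist_lactE.
- by rewrite !phiE; apply: twist_ractE.
Qed.

End CyclicTensor.

Theorem mainTheorem4
  (r : nat) (r_gt0 : (0 < r)%N)
  (R : comUnitRingType) (r_unit : (r%:R : R) \is a GRing.unit)
  (eps : R) (eps_prim : primitive_unity_root r eps)
  (A : unitAlgType R)
  (B : {pred A}) (B_subalg : GRing.subalg_closed B)
  (s : nat) (b : 'I_s -> A) (b_basis : is_basis (fun x : A => x \in B) b)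
  (a : A) (a_unit : a \is a GRing.unit)
  (aB_Ba : forall y : A, lmul_set a B y <-> rmul_set B a y)
  (ar_B : a ^+ r \in B)
  (A_graded : Zmod_graded r (fun j => lmul_set (a ^+ j) B))
  (sigma : {lrmorphism A -> A}) (sigma_bij : bijective sigma)
  (sigmaE : forall (j : int) (x : A), x \in B ->
     sigma (a ^ j * x) = eps ^ j *: (a ^ j * x)) :
  is_basis (fun _ : tensor B => True) (@tens_family R A B r s a b) /\
  (exists phi : tensor B -> {ffun 'I_r -> A}, phi_spec eps a b phi) /\
  (forall phi : tensor B -> {ffun 'I_r -> A}, phi_spec eps a b phi ->
     bimod_isomorphism (M := tensor_bimod B_subalg)
       (N := twisted_sum_bimod sigma r) phi).
Proof.
split; first exact: (tens_family_basis (eps := eps) (sigma := sigma)).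
split=> [|phi phi_ok].
  by exists (twist (B := B) r sigma); apply: twist_spec.
apply: (twist_isomorphism r_gt0 r_unit eps_prim B_subalg a_unit aB_Ba A_graded
  sigmaE).
exact: (phi_spec_twist r_gt0 r_unit eps_prim B_subalg b_basis a_unit aB_Ba
  A_graded sigmaE).
Qed.
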